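(* Let $F$ be a punctured surface of genus $g\ge 0$ with $s\ge1$ punctures, $2g+s-2>0$, with ideal triangulation $\Delta$, dual fatgraph spine $\tau$, and an orientation $\omega$ of $\tau$ representing a spin structure, and consider a point of the corresponding component of the decorated super Teichmüller space of $F$ with its associated representation $\hat\rho:\pi_1(F)\to OSp(1|2)$. For each Ramond puncture of $F$, let $\tau_1,\dots,\tau_n$ be the triangles around it in counterclockwise order, with odd coordinates $\theta_1,\dots,\theta_n$, cross ratios $\chi_1,\dots,\chi_n$, signs $\epsilon_1,\dots,\epsilon_n$, and let $c_k=-\epsilon_k\sqrt{\chi_k}$. Then the monodromy constraint at this Ramond puncture is equivalent to the linear equation in the $\theta_i$ $$\sum_{i=1}^n\theta_i\prod_{j=1}^{i-1}c_j^{-1}=0,$$ that is, $$\theta_1-\theta_2\frac{\epsilon_1}{\sqrt{\chi_1}}+\theta_3\frac{\epsilon_1\epsilon_2}{\sqrt{\chi_1\chi_2}}-\cdots+(-1)^{n-1}\theta_n\frac{\epsilon_1\cdots\epsilon_{n-1}}{\sqrt{\chi_1\cdots\chi_{n-1}}}=0,$$ or equivalently (upon multiplication by $\prod_{k=1}^n c_k$) $$\sum_{i=1}^n\theta_i\prod_{j=i}^{n}c_j=0,$$ that is, $$\theta_1\sqrt{\chi_1\cdots\chi_n}\,\epsilon_1\cdots\epsilon_n-\theta_2\sqrt{\chi_2\cdots\chi_n}\,\epsilon_2\cdots\epsilon_n+\cdots+(-1)^{n-1}\theta_n\sqrt{\chi_n}\,\epsilon_n=0.$$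
   Context: Supernumbers are elements of a real Grassmann algebra; even ones commute with everything, odd ones anticommute with each other; the body $x_\#$ of a supernumber $x$ is its real part modulo nilpotents; the square root of an even supernumber with positive body is the one with positive body. Supermatrices are $3\times 3$ arrays $$g=\begin{pmatrix}a&\alpha&b\\ \gamma&f&\beta\\ c&\delta&d\end{pmatrix}$$ with $a,b,c,d,f$ even and $\alpha,\beta,\gamma,\delta$ odd. Multiplication is row-by-column with the convention that each product of two odd entries gets an additional minus sign; e.g. the $(1,1)$ entry of $g g'$ is $aa'-\alpha\gamma'+bc'$. The supertranspose is $$g^{st}=\begin{pmatrix}a&\gamma&c\\-\alpha&f&-\delta\\ b&\beta&d\end{pmatrix},\qquad J=\begin{pmatrix}0&0&1\\0&1&0\\-1&0&0\end{pmatrix}.$$ $OSp(1|2)$ is the group of such supermatrices with $f_\#>0$ and $g^{st}Jg=J$ (these automatically have superdeterminant $1$). There is a projection $OSp(1|2)\to SL(2,\mathbb R)$, $g\mapsto \frac{1}{\sqrt{f_\#}}\begin{pmatrix}a_\#&b_\#\\ c_\#&d_\#\end{pmatrix}$. Notation: $$Z_{\epsilon}=\begin{pmatrix}\epsilon&0&0\\0&1&0\\0&0&\epsilon\end{pmatrix}\ (\epsilon=\pm1),\quad \Upsilon^\chi=J\begin{pmatrix}\sqrt\chi&0&0\\0&1&0\\0&0&1/\sqrt\chi\end{pmatrix},\quad P^+_\theta=\begin{pmatrix}-1&\theta&1\\-\theta&1&0\\-1&0&0\end{pmatrix}.$$ Coordinates. The special light cone is the $OSp(1|2)$-orbit of $(1,0,0|0,0)$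 in super Minkowski space $\mathbb R^{2,1|2}$. The decorated super Teichmüller space of $F$ is the space of $OSp(1|2)$-orbits of $\pi_1(F)$-equivariant lifts of the ideal vertices of the universal cover to the special light cone, for super Fuchsian representations $\hat\rho:\pi_1(F)\to OSp(1|2)$ (those whose projection to $PSL(2,\mathbb R)$ is Fuchsian). Its components correspond to spin structures on $F$, represented by orientations $\omega$ of the edges of the trivalent fatgraph spine $\tau$ dual to $\Delta$ (two orientations being equivalent if related by reversing all edges at vertices). Each component has coordinates given by an even $\lambda$-length (with positive body) for each edge of $\Delta$ and an odd $\mu$-invariant for each triangle of $\Delta$ (the odd ones taken modulo an overall sign). Monodromy. Let $\gamma=(\tau_1,\dots,\tau_n,\tau_1)$ be the loop in $\tau$ going counterclockwise around a puncture $A$, passing through the (lifted) triangles $\tau_k=AB_{k+1}B_k$ around $A$. Let $\theta_k$ be the odd coordinate ($\mu$-invariant) of $\tau_k$; let $\chi_k=\dfrac{\lambda(B_kB_{k+1})\,\lambda(AB_{k+2})}{\lambda(AB_k)\,\lambda(B_{k+1}B_{k+2})}$ be the cross ratio of the quadrilateral formed by $\tau_k,\tau_{k+1}$ (indices mod $n$), so $\prod_k\chi_k=1$; and let $\epsilon_k=-1$ if the segment $\tau_k\to\tau_{k+1}$ of $\gamma$ has the same orientation as $\omega$, $\epsilon_k=+1$ otherwise. With the lift of the puncture normalized to $A=r(0,1,0|0,0)$, $r>0$, the construction of $\hat\rho$ gives $$\hat\rho(\gamma)=\prod_{k=1}^n Z_{\epsilon_k}\Upsilon^{\chi_k}P^+_{\theta_k},$$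 the product being read from right to left (the factor $k=1$ is rightmost). The puncture is Ramond (resp. Neveu-Schwarz) if the projection of $\hat\rho(\gamma)$ to $SL(2,\mathbb R)$ has trace $2$ (resp. $-2$). Monodromy constraint. The elements of $OSp(1|2)$ fixing $A=r(0,1,0|0,0)$ are exactly the lower triangular matrices $\begin{pmatrix}\pm1&0&0\\ \theta&1&0\\ b&\mp\theta&\pm1\end{pmatrix}$ with $\theta$ odd, $b$ even (signs correlated). The monodromy constraint at the puncture requires that there be $U\in OSp(1|2)$ fixing $A$ such that $U\hat\rho(\gamma)U^{-1}=\begin{pmatrix}\pm1&0&0\\ 0&1&0\\ b'&0&\pm1\end{pmatrix}$ for some even $b'$ (the same sign in both places). *)

(* Defs.v *)
From HB Require Import structures.
From mathcomp Require Import all_boot all_order all_algebra all_fingroup.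
From mathcomp Require Import finmap xfinmap monalg.
From mathcomp Require Import boolp classical_sets reals.

Set Implicit Arguments.
Unset Strict Implicit.
Unset Printing Implicit Defensive.

Import Order.TTheory GRing.Theory Num.Theory.

Local Open Scope ring_scope.

Section ClassicalInverse.
Variable A : nzRingType.

Definition cunit : pred A := fun x => `[< exists y, y * x = 1 /\ x * y = 1 >].
Definition cinv (x : A) : A :=
  xget x [set y | y * x = 1 /\ x * y = 1]%classic.

Lemma cinvP x : cunit x -> cinv x * x = 1 /\ x * cinv x = 1.
Proof.
move=> /asboolP[y hy].
by have := @xgetPex _ x _ (ex_intro _ y hy : exists y, [set y | y * x = 1 /\ x * y = 1]%classic y).
Qed.

Lemma cmulVr : {in cunit, left_inverse 1 cinv *%R}.
Proof. by move=> x /cinvP[]. Qed.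

Lemma cdivrr : {in cunit, right_inverse 1 cinv *%R}.
Proof. by move=> x /cinvP[]. Qed.

Lemma cunitrP x y : y * x = 1 /\ x * y = 1 -> cunit x.
Proof. by move=> h; apply/asboolP; exists y. Qed.

Lemma cinvr_out : {in [predC cunit], cinv =1 id}.
Proof.
move=> x; rewrite inE /= => /negP nx; rewrite /cinv.
by apply: xgetPN => y [h1 h2]; apply: nx; apply/asboolP; exists y.
Qed.
End ClassicalInverse.

Section Grassmann.
Variables (disp : Order.disp_t) (I : orderType disp) (R : realType).

(* The Grassmann algebra over R on generators e_i (i : I): the free R-module on
   the monomials e_S = e_{i_1} ... e_{i_k}, S = {i_1 < ... < i_k} a finite
   subset of I.  I = 'I_N gives N generators, I = nat countably many. *)
Definition super : Type := {malg R[{fset I}]}.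
HB.instance Definition _ := GRing.Lmodule.on super.

Local Open Scope fset_scope.

Definition inversions (S T : {fset I}) : nat :=
  (\sum_(i <- S) \sum_(j <- T) (j < i)%O)%N.

(* e_S e_T = wedge_coef S T * e_{S u T} *)
Definition wedge_coef (S T : {fset I}) : R :=
  if [disjoint S & T]%fset then (-1) ^+ inversions S T else 0.

(* Locked, as unification would otherwise unfold products. *)
Fact super_mul_key : unit. Proof. by []. Qed.
Definition super_mul : super -> super -> super :=
  locked_with super_mul_key (fun x y =>
    \sum_(S <- msupp x) \sum_(T <- msupp y)
      << wedge_coef S T * x@_S * y@_T *g S `|` T >>).

Lemma super_mul_def (x y : super) : super_mul x y =
  \sum_(S <- msupp x) \sum_(T <- msupp y)
    << wedge_coef S T * x@_S * y@_T *g S `|` T >>.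
Proof. by rewrite /super_mul locked_withE. Qed.

Definition super_one : super := << 1 *g fset0 >>.

Lemma inversions0l T : inversions fset0 T = 0%N.
Proof. by rewrite /inversions big_seq_fset0. Qed.

Lemma inversions0r S : inversions S fset0 = 0%N.
Proof.
by rewrite /inversions big1 // => i _; rewrite big_seq_fset0.
Qed.

Lemma big_disjU (F : I -> nat) (S T : {fset I}) : [disjoint S & T]%fset ->
  (\sum_(i <- S `|` T) F i = \sum_(i <- S) F i + \sum_(i <- T) F i)%N.
Proof.
move=> dST; rewrite -big_cat; apply: perm_big; apply: uniq_perm.
- exact: fset_uniq.
- rewrite cat_uniq !fset_uniq andbT /=; apply/hasPn => i iT.
  by apply/negP => iS; move/fdisjointP: dST => /(_ i iS); rewrite iT.
- by move=> i; rewrite mem_cat in_fsetU.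
Qed.

Lemma inversionsUl S T U : [disjoint S & T]%fset ->
  inversions (S `|` T) U = (inversions S U + inversions T U)%N.
Proof. by move=> dST; rewrite /inversions big_disjU. Qed.

Lemma inversionsUr S T U : [disjoint T & U]%fset ->
  inversions S (T `|` U) = (inversions S T + inversions S U)%N.
Proof.
move=> dTU; rewrite /inversions -big_split /=; apply: eq_bigr => i _.
by rewrite big_disjU.
Qed.

Lemma wedge_coefA S T U :
  wedge_coef S T * wedge_coef (S `|` T) U =
  wedge_coef T U * wedge_coef S (T `|` U).
Proof.
rewrite /wedge_coef fdisjointUX fdisjointXU.
case dST: [disjoint S & T]%fset; case dTU: [disjoint T & U]%fset;
  case dSU: [disjoint S & U]%fset; rewrite ?(mul0r, mulr0) //=.
rewrite -!exprD inversionsUl // inversionsUr //.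
by congr (_ ^+ _); rewrite [RHS]addnC addnA.
Qed.

Lemma super_mulw (D E : {fset {fset I}}) (x y : super) :
  msupp x `<=` D -> msupp y `<=` E ->
  super_mul x y = \sum_(S <- D) \sum_(T <- E)
    << wedge_coef S T * x@_S * y@_T *g S `|` T >>.
Proof.
move=> hD hE; rewrite super_mul_def (big_fset_incl _ hD) /=.
  apply/eq_bigr=> k1 _; apply/big_fset_incl => // k _ /mcoeff_outdom ->.
  by rewrite mulr0 monalgU0.
move=> k _ /mcoeff_outdom xk.
by rewrite big1 => // k' _; rewrite xk mulr0 mul0r monalgU0.
Qed.

Lemma super_mulDl : left_distributive super_mul +%R.
Proof.
move=> x y z; rewrite [in RHS](super_mulw (fsubsetUl _ (msupp y)) (fsubset_refl _)).
rewrite [in RHS](super_mulw (fsubsetUr (msupp x) _) (fsubset_refl _)).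
rewrite (super_mulw (msuppD_le _ _) (fsubset_refl _)).
rewrite -big_split /=; apply/eq_bigr=> S _.
rewrite -big_split /=; apply/eq_bigr=> T _.
by rewrite mcoeffD mulrDr mulrDl monalgUD.
Qed.

Lemma super_mulDr : right_distributive super_mul +%R.
Proof.
move=> z x y; rewrite [in RHS](super_mulw (fsubset_refl _) (fsubsetUl _ (msupp y))).
rewrite [in RHS](super_mulw (fsubset_refl _) (fsubsetUr (msupp x) _)).
rewrite (super_mulw (fsubset_refl _) (msuppD_le _ _)).
rewrite -big_split /=; apply/eq_bigr=> S _.
rewrite -big_split /=; apply/eq_bigr=> T _.
by rewrite mcoeffD mulrDr monalgUD.
Qed.

Lemma super_mul0l : left_zero 0 super_mul.
Proof. by move=> x; rewrite super_mul_def msupp0 big_seq_fset0. Qed.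

Lemma super_mul0r : right_zero 0 super_mul.
Proof.
by move=> x; rewrite super_mul_def big1 // => S _; rewrite msupp0 big_seq_fset0.
Qed.

Lemma super_mulUU (a b : R) S T :
  super_mul << a *g S >> << b *g T >> =
  << wedge_coef S T * a * b *g S `|` T >>.
Proof.
by rewrite (super_mulw msuppU_le msuppU_le) !big_seq_fset1 !mcoeffUU.
Qed.

Lemma super_mulE x y : super_mul x y =
  \sum_(S <- msupp x) \sum_(T <- msupp y)
    super_mul << x@_S *g S >> << y@_T *g T >>.
Proof.
by rewrite super_mul_def; apply: eq_bigr => S _; apply: eq_bigr => T _; rewrite super_mulUU.
Qed.

Lemma super_mul_suml (J : Type) (r : seq J) (F : J -> super) y :
  super_mul (\sum_(j <- r) F j) y = \sum_(j <- r) super_mul (F j) y.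
Proof.
exact: (big_morph (super_mul^~ y) (fun _ _ => super_mulDl _ _ _) (super_mul0l _)).
Qed.

Lemma super_mul_sumr (J : Type) (r : seq J) (F : J -> super) x :
  super_mul x (\sum_(j <- r) F j) = \sum_(j <- r) super_mul x (F j).
Proof.
exact: (big_morph (super_mul x) (fun _ _ => super_mulDr _ _ _) (super_mul0r _)).
Qed.

Lemma super_mulA : associative super_mul.
Proof.
move=> x y z; rewrite [x]monalgE [y]monalgE [z]monalgE.
rewrite [LHS]super_mul_suml [X in _ = super_mul X _]super_mul_suml.
rewrite [RHS]super_mul_suml; apply: eq_bigr => S _.
rewrite [X in super_mul _ X = _]super_mul_suml [LHS]super_mul_sumr.
rewrite [X in _ = super_mul X _]super_mul_sumr [RHS]super_mul_suml.
apply: eq_bigr => T _.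
rewrite [X in super_mul _ X = _]super_mul_sumr [LHS]super_mul_sumr.
rewrite [RHS]super_mul_sumr; apply: eq_bigr => U _.
rewrite !super_mulUU fsetUA; congr << _ *g _ >>.
rewrite !mulrA [wedge_coef S (T `|` U) * _]mulrC.
rewrite [_ * wedge_coef T U]mulrC.
rewrite -!mulrA [in LHS](mulrCA (x@_S)) !mulrA.
by rewrite -wedge_coefA [wedge_coef (S `|` T) U * wedge_coef S T]mulrC.
Qed.

Lemma super_mul1l : left_id super_one super_mul.
Proof.
move=> x; rewrite [x]monalgE super_mul_sumr; apply: eq_bigr => S _.
by rewrite super_mulUU fset0U /wedge_coef fdisjoint0X inversions0l !mul1r.
Qed.

Lemma super_mul1r : right_id super_one super_mul.
Proof.
move=> x; rewrite [x]monalgE super_mul_suml; apply: eq_bigr => S _.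
by rewrite super_mulUU fsetU0 /wedge_coef fdisjointX0 inversions0r mulr1 mul1r.
Qed.

Lemma super_oner_neq0 : super_one != 0.
Proof. by rewrite monalgU_eq0 oner_eq0. Qed.

HB.instance Definition _ := GRing.Zmodule_isNzRing.Build super
  super_mulA super_mul1l super_mul1r super_mulDl super_mulDr super_oner_neq0.

HB.instance Definition _ := GRing.NzRing_hasMulInverse.Build super
  (@cmulVr super) (@cdivrr super) (@cunitrP super) (@cinvr_out super).

Lemma superM (x y : super) : x * y =
  \sum_(S <- msupp x) \sum_(T <- msupp y)
    << wedge_coef S T * x@_S * y@_T *g S `|` T >>.
Proof. exact: super_mul_def. Qed.

End Grassmann.

Section SuperNumbers.
Variables (disp : Order.disp_t) (I : orderType disp) (R : realType).
Local Notation Lam := (super I R).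

Definition even_super (x : Lam) := forall S : {fset I}, x@_S != 0 -> ~~ odd #|` S|.
Definition odd_super (x : Lam) := forall S : {fset I}, x@_S != 0 -> odd #|` S|.
Definition body (x : Lam) : R := x@_(fset0 : {fset I}).

Definition is_super_sqrt (x y : Lam) :=
  [/\ even_super y, 0 < body y & y ^+ 2 = x].

(* The square root of an even x of positive body; such a root exists and is
   unique.  For other x the value is irrelevant. *)
Definition super_sqrt (x : Lam) : Lam := xget 0 [set y | is_super_sqrt x y]%classic.

End SuperNumbers.

Section SuperMatrices.
Variables (disp : Order.disp_t) (I : orderType disp) (R : realType).
Local Notation Lam := (super I R).

(* 3 x 3 arrays over Lam; the middle row and column are the odd ones. *)
Definition supermx : Type := 'M[Lam]_3.
HB.instance Definition _ := GRing.Zmodule.on supermx.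

Definition entry (M : supermx) (i j : 'I_3) : Lam := fun_of_matrix M i j.

Definition smx (a al b ga f be c de d : Lam) : supermx :=
  \matrix_(i, j)
    nth 0 (nth [::] [:: [:: a; al; b]; [:: ga; f; be]; [:: c; de; d]] i) j.

Definition odd_pos (i j : 'I_3) : bool := (i == 1) (+) (j == 1).

Fact supermx_mul_key : unit. Proof. by []. Qed.
Definition supermx_mul : supermx -> supermx -> supermx :=
  locked_with supermx_mul_key (fun M N => \matrix_(i, j) \sum_k
    (if odd_pos i k && odd_pos k j then - (entry M i k * entry N k j)
     else entry M i k * entry N k j)).

Definition supermx_one : supermx := (1%:M : 'M[Lam]_3).

Lemma entryP (M N : supermx) : (forall i j, entry M i j = entry N i j) -> M = N.
Proof. by move=> h; apply/matrixP. Qed.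

Lemma entryM M N i j : entry (supermx_mul M N) i j = \sum_k
    (if odd_pos i k && odd_pos k j then - (entry M i k * entry N k j)
     else entry M i k * entry N k j).
Proof. by rewrite /supermx_mul locked_withE /entry mxE. Qed.

Lemma entryD (M N : supermx) i j : entry (M + N) i j = entry M i j + entry N i j.
Proof. by rewrite /entry mxE. Qed.

Lemma entry1 i j : entry supermx_one i j = (i == j)%:R.
Proof. by rewrite /entry mxE. Qed.

Lemma entry0 i j : entry 0 i j = 0.
Proof. by rewrite /entry mxE. Qed.

Lemma entry_smx a al b ga f be c de d i j :
  entry (smx a al b ga f be c de d) i j =
  nth 0 (nth [::] [:: [:: a; al; b]; [:: ga; f; be]; [:: c; de; d]] i) j.
Proof. by rewrite /entry mxE. Qed.

Lemma supermx_mulA : associative supermx_mul.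
Proof.
move=> A B C; apply/entryP => i j; rewrite [LHS]entryM [RHS]entryM.
transitivity (\sum_k \sum_l
   (if odd_pos i k && odd_pos k j (+) odd_pos k l && odd_pos l j
    then - (entry A i k * entry B k l * entry C l j)
    else entry A i k * entry B k l * entry C l j)).
  apply: eq_bigr => k _; rewrite (entryM B C k j) mulr_sumr -sumrN; case: ifP => h;
  apply: eq_bigr => l _; case: (odd_pos k l && odd_pos l j) => /=;
    by rewrite ?mulrN ?mulrA ?opprK.
rewrite exchange_big /=; apply: eq_bigr => l _.
rewrite (entryM A B i l) mulr_suml -sumrN -(fun_if (fun F => \sum_k F k)).
apply: eq_bigr => k _; rewrite if_arg (fun_if ( *%R^~ (entry C l j))) mulNr.
move: (_ * _ * _) => X; rewrite /odd_pos.
by case: (i == 1); case: (j == 1); case: (k == 1); case: (l == 1);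
  rewrite /= ?opprK.
Qed.

Lemma supermx_mul1l : left_id supermx_one supermx_mul.
Proof.
move=> A; apply/entryP => i j; rewrite entryM (bigD1 i) //= big1 => [|k nki].
  by rewrite addr0 entry1 eqxx /odd_pos addbb mul1r.
by rewrite entry1 eq_sym (negbTE nki) mul0r oppr0 if_same.
Qed.

Lemma supermx_mul1r : right_id supermx_one supermx_mul.
Proof.
move=> A; apply/entryP => i j; rewrite entryM (bigD1 j) //= big1 => [|k nki].
  by rewrite addr0 entry1 eqxx /odd_pos addbb andbF mulr1.
by rewrite entry1 (negbTE nki) mulr0 oppr0 if_same.
Qed.

Lemma supermx_mulDl : left_distributive supermx_mul +%R.
Proof.
move=> A B C; apply/entryP => i j; rewrite entryD (entryM _ C) (entryM A) (entryM B) -big_split /=.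
by apply: eq_bigr => k _; rewrite entryD mulrDl; case: ifP => // _; rewrite opprD.
Qed.

Lemma supermx_mulDr : right_distributive supermx_mul +%R.
Proof.
move=> A B C; apply/entryP => i j; rewrite entryD (entryM _ (B + C)) (entryM A B) (entryM A C) -big_split /=.
by apply: eq_bigr => k _; rewrite entryD mulrDr; case: ifP => // _; rewrite opprD.
Qed.

Lemma supermx_oner_neq0 : supermx_one != 0.
Proof.
apply/eqP => /(congr1 (fun M => entry M 0 0)); rewrite entry1 entry0 /=.
by move/eqP; rewrite oner_eq0.
Qed.

HB.instance Definition _ := GRing.Zmodule_isNzRing.Build supermx
  supermx_mulA supermx_mul1l supermx_mul1r supermx_mulDl supermx_mulDr
  supermx_oner_neq0.

HB.instance Definition _ := GRing.NzRing_hasMulInverse.Build supermx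
  (@cmulVr supermx) (@cdivrr supermx) (@cunitrP supermx) (@cinvr_out supermx).

Lemma entry_mul (M N : supermx) i j : entry (M * N) i j = \sum_k
    (if odd_pos i k && odd_pos k j then - (entry M i k * entry N k j)
     else entry M i k * entry N k j).
Proof. exact: entryM. Qed.

Definition supertranspose (M : supermx) : supermx :=
  let m := entry M in
  smx    (m 0 0)  (m 1 0)    (m 2 0)
      (- m 0 1)   (m 1 1) (- m 2 1)
         (m 0 2)  (m 1 2)    (m 2 2).

Definition Jmx : supermx := smx 0 0 1 0 1 0 (-1) 0 0.

Definition OSp (M : supermx) : Prop :=
  [/\ forall i j, if odd_pos i j then odd_super (entry M i j)
                  else even_super (entry M i j),
      0 < body (entry M 1 1)
    & supertranspose M * Jmx * M = Jmx].

Definition SL2_proj (M : supermx) : 'M[R]_2 :=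
  let ext (i : 'I_2) : 'I_3 := if i == 0 then 0 else 2 in
  (Num.sqrt (body (entry M 1 1)))^-1 *:
    \matrix_(i, j) body (entry M (ext i) (ext j)).

(* The point (x1, x2, y | phi, theta) of super Minkowski space R^{2,1|2}, as a
   symmetric supermatrix.  OSp(1|2) acts by M |-> g M g^st, which preserves the
   quadratic form x1 x2 - y^2 + 2 phi theta; with this convention the stabilizer
   of r (0, 1, 0 | 0, 0) consists of the lower triangular elements of OSp(1|2). *)
Definition minkowski (x1 x2 y phi theta : Lam) : supermx :=
  smx x1  phi       y
      phi 0         (- theta)
      y   (- theta) x2.

Definition minkowski_act (g P : supermx) : supermx := g * P * supertranspose g.

Definition Zmx (e : Lam) : supermx := smx e 0 0 0 1 0 0 0 e.
Definition Upsilon (chi : Lam) : supermx :=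
  Jmx * smx (super_sqrt chi) 0 0 0 1 0 0 0 (super_sqrt chi)^-1.
Definition Pplus (theta : Lam) : supermx :=
  smx (-1) theta 1 (- theta) 1 0 (-1) 0 0.

(* [P] is the lift of the puncture and [M] the monodromy around it. *)
Definition monodromy_constraint (P M : supermx) : Prop :=
  exists (U : supermx) (e : bool) (b : Lam),
    [/\ OSp U, minkowski_act U P = P, even_super b
      & U * M * U^-1 = smx ((-1) ^+ e) 0 0 0 1 0 b 0 ((-1) ^+ e)].

End SuperMatrices.

(* An ideal triangulation of the genus g surface with s punctures, as a
   combinatorial map.  A [side] is a side of a triangle, equivalently a half-edge
   of the dual trivalent fatgraph: [rot] sends a side to the next side of the same
   triangle in counterclockwise order, [flip] to the side glued to it.  Triangles
   are the orbits of [rot], edges those of [flip]. *)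
Record ideal_triangulation (g s : nat) := IdealTriangulation {
  side : finType;
  rot : {perm side};
  flip : {perm side};
  rotK : forall d, rot (rot (rot d)) = d;
  rot_neq : forall d, rot d != d;
  flipK : forall d, flip (flip d) = d;
  flip_neq : forall d, flip d != d;
  side_connected :
    forall d d', connect (fun x y => (y == rot x) || (y == flip x)) d d';
  (* [rot^-1 \o flip], see [turn] below *)
  card_punctures : #|porbits (flip * rot^-1)%g| = s;
  euler_char : (#|porbits rot| + s + g.*2 = #|porbits flip| + 2)%N
}.

Section Coordinates.
Variables (disp : Order.disp_t) (I : orderType disp) (R : realType).
Variables (g s : nat) (T : ideal_triangulation g s).
Local Notation Lam := (super I R).

(* Let d be the side AB' of the triangle AB'B, where A, B, B' is the
   counterclockwise order.  Then rot d = AB and rot (rot d) = BB'.  Crossing d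
   counterclockwise around A leads to the triangle AB''B', and turn d is its side
   AB''.  So the orbits of [turn] are the punctures, and the orbit of d lists the
   triangles around A in counterclockwise order, as often as A is a corner. *)
Definition turn : {perm side T} := (flip T * (rot T)^-1)%g.

(* [om d] holds when the dual edge crossing d points out of the triangle of d. *)
Record orientation := Orientation {
  orient :> side T -> bool;
  orient_flip : forall d, orient (flip T d) = ~~ orient d
}.

(* A point of a component of the decorated super Teichmueller space, in its
   coordinates. *)
Record super_point := SuperPoint {
  lambda : side T -> Lam;
  mu : side T -> Lam;
  lambda_flip : forall d, lambda (flip T d) = lambda d;
  lambda_even : forall d, even_super (lambda d);
  lambda_body : forall d, 0 < body (lambda d);
  mu_rot : forall d, mu (rot T d) = mu d;
  mu_odd : forall d, odd_super (mu d)
}.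

Section Loop.
Variables (om : orientation) (p : super_point) (d : side T).

(* The loop around the puncture of d that starts in the triangle of d.  Indices
   start at 0: tau_{k+1} is the triangle of [exit_side k], which is the side
   A B_{k+2} crossed from tau_{k+1} to tau_{k+2}. *)
Definition valence : nat := #|porbit turn d|.
Definition exit_side (k : nat) : side T := (turn ^+ k)%g d.

Definition theta (k : nat) : Lam := mu p (exit_side k).

Definition chi (k : nat) : Lam :=
  let h := exit_side k in let h' := exit_side k.+1 in
  lambda p (rot T (rot T h)) * lambda p h' /
  (lambda p (rot T h) * lambda p (rot T (rot T h'))).

Definition eps (k : nat) : Lam := if om (exit_side k) then -1 else 1.

Definition cc (k : nat) : Lam := - eps k * super_sqrt (chi k).

(* rho(gamma); the factor of tau_1 is the rightmost one. *)
Definition monodromy : supermx I R :=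
  \prod_(k < valence)
    (let j := rev_ord k in Zmx (eps j) * Upsilon (chi j) * Pplus (theta j)).

Definition ramond : Prop := \tr (SL2_proj monodromy) = 2.

End Loop.
End Coordinates.

(* Main.v *)
Require Import Defs.
From mathcomp Require Import all_boot all_order all_algebra all_fingroup.
From mathcomp Require Import finmap monalg boolp classical_sets reals.

Set Implicit Arguments.
Unset Strict Implicit.
Unset Printing Implicit Defensive.

Import Order.TTheory GRing.Theory Num.Theory.

Local Open Scope ring_scope.

(** With c_k = - eps_k sqrt chi_k, the k-th factor of the monodromy is the lower
triangular supermatrix with rows (1/c_k, 0, 0), (- theta_k, 1, 0) and
(- c_k, c_k theta_k, c_k) ([monodromy_factor]).  Hence the whole product is lower
triangular, with diagonal 1/E, 1, E, where E is the product of all c_k, with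
(2,1) entry - S, where S = sum_i theta_i prod_(j < i) 1/c_j, and with (3,2) entry
S E ([lower_product]).  The cross ratios around a puncture have product 1
([prod_chi]), so E is a sign, and the Ramond condition makes it 1
([ramond_prod_cc]).  The monodromy then has rows (1, 0, 0), (- S, 1, 0) and
(C, S, 1), with C even.

If S = 0 this already has the required form.  Conversely, an element U of
OSp(1|2) that fixes the lift of the puncture is lower triangular with middle
diagonal entry f of square 1 ([stabilizer_lower]); comparing the (2,1) entries of
U M = M' U gives f S = 0, so S = 0 ([constraint_lower]).  All four sums in the
theorem are S up to the factors E and (-1)^n.

The even part of the Grassmann algebra must be understood first: even elements
are central ([even_central]), those of nonzero body are invertible with even
inverse ([even_super_inverse]), and those of positive body have exactly one even
square root of positive body ([super_sqrt_exists], [super_sqrt_eq]), so that the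
square root is multiplicative. *)

(** * Parity, body and centrality in the Grassmann algebra *)

Section Supernumbers.
Variables (disp : Order.disp_t) (I : orderType disp) (R : realType).
Local Notation Lam := (super I R).
Implicit Types (x y z : Lam) (S : {fset I}) (a b : R) (D E G : pred {fset I}).

(** A common form for parity and degree conditions: [even_super] and [odd_super]
are instances up to conversion, so the closure lemmas below serve them all. *)
Definition supp_in D x := forall S, x@_S != 0 -> D S.

Lemma supp_in_sub D E x : (forall S, D S -> E S) -> supp_in D x -> supp_in E x.
Proof. by move=> DE Dx S /Dx /DE. Qed.

Lemma supp_in0 D : supp_in D 0.
Proof. by move=> S; rewrite mcoeff0 eqxx. Qed.

Lemma supp_inU D a S : D S -> supp_in D << a *g S >>.
Proof.
by move=> DS S'; rewrite mcoeffU; have [<-|] := eqVneq S S'; rewrite ?eqxx.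
Qed.

Lemma supp_inD D x y : supp_in D x -> supp_in D y -> supp_in D (x + y).
Proof.
move=> Dx Dy S; rewrite mcoeffD; have [x0|/Dx //] := eqVneq x@_S 0.
by rewrite x0 add0r => /Dy.
Qed.

Lemma supp_inN D x : supp_in D x -> supp_in D (- x).
Proof. by move=> Dx S; rewrite mcoeffN oppr_eq0 => /Dx. Qed.

Lemma supp_inB D x y : supp_in D x -> supp_in D y -> supp_in D (x - y).
Proof. by move=> Dx Dy; apply: supp_inD Dx _; apply: supp_inN. Qed.

Lemma supp_in_sum D (J : eqType) (r : seq J) (P : pred J) (F : J -> Lam) :
  (forall j, j \in r -> P j -> supp_in D (F j)) ->
  supp_in D (\sum_(j <- r | P j) F j).
Proof.
move=> DF; rewrite big_seq_cond; apply: big_ind => [||j /andP[]].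
- exact: supp_in0.
- by move=> x y; apply: supp_inD.
- exact: DF.
Qed.

Lemma supp_inM D E G x y :
    (forall S T, D S -> E T -> [disjoint S & T]%fset -> G (S `|` T)%fset) ->
  supp_in D x -> supp_in E y -> supp_in G (x * y).
Proof.
move=> DEG Dx Ey; rewrite superM.
apply: supp_in_sum => S; rewrite -mcoeff_neq0 => /Dx DS _.
apply: supp_in_sum => T; rewrite -mcoeff_neq0 => /Ey ET _.
rewrite /wedge_coef; case: ifPn => [dST|_].
  by apply: supp_inU; apply: DEG.
by rewrite !mul0r monalgU0; apply: supp_in0.
Qed.

Lemma card_disjointU (S T : {fset I}) : [disjoint S & T]%fset ->
  #|` (S `|` T)%fset| = (#|` S| + #|` T|)%N.
Proof. by move=> /eqP dST; rewrite cardfsU dST cardfs0 subn0. Qed.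

Lemma even_superM x y : even_super x -> even_super y -> even_super (x * y).
Proof.
apply: supp_inM => S T /negbTE oS /negbTE oT dST.
by rewrite card_disjointU // oddD oS oT.
Qed.

Lemma even_superN x : even_super x -> even_super (- x).
Proof. exact: supp_inN. Qed.

Lemma odd_superM x y : odd_super x -> odd_super y -> even_super (x * y).
Proof.
by apply: supp_inM => S T oS oT dST; rewrite card_disjointU // oddD oS oT.
Qed.

Lemma odd_even_superM x y : odd_super x -> even_super y -> odd_super (x * y).
Proof.
apply: supp_inM => S T oS /negbTE oT dST.
by rewrite card_disjointU // oddD oS oT.
Qed.

Definition scalar a : Lam := << a *g fset0 >>.

Lemma scalarM a b : scalar a * scalar b = scalar (a * b).
Proof.
rewrite [LHS]super_mulUU fset0U /wedge_coef fdisjoint0X.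
by rewrite inversions0l expr0 mul1r.
Qed.

Lemma even_scalar a : even_super (scalar a).
Proof. by apply: supp_inU; rewrite cardfs0. Qed.

Lemma even_super1 : even_super (1 : Lam). Proof. exact: even_scalar. Qed.

Lemma body_scalar a : body (scalar a) = a.
Proof. exact: mcoeffUU. Qed.

Lemma supp_in_soul x : supp_in (fun S => 0 < #|` S|)%N (x - scalar (body x)).
Proof.
move=> S; rewrite lt0n cardfs_eq0; apply: contra => /eqP->.
by rewrite mcoeffB mcoeffUU subrr.
Qed.

Lemma supp_in_body0 x : supp_in (fun S => 0 < #|` S|)%N x -> body x = 0.
Proof.
by move=> xS; apply/eqP; apply: contraT => /xS; rewrite cardfs0.
Qed.

Lemma bodyD x y : body (x + y) = body x + body y.
Proof. exact: mcoeffD. Qed.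

Lemma bodyN x : body (- x) = - body x.
Proof. exact: mcoeffN. Qed.

Lemma body1 : body (1 : Lam) = 1.
Proof. exact: body_scalar. Qed.

(** A product with a factor of zero body has support in positive degree. *)
Lemma bodyM x y : body (x * y) = body x * body y.
Proof.
rewrite -{1}(subrK (scalar (body x)) x) mulrDl bodyD.
rewrite -[X in scalar _ * X](subrK (scalar (body y)) y).
rewrite [scalar _ * _]mulrDr bodyD scalarM body_scalar.
rewrite (@supp_in_body0 (_ * y)) 1?(@supp_in_body0 (_ * (_ - _))) ?add0r //.
  apply: (@supp_inM xpredT _ _ _ _ _ _ (@supp_in_soul y)) => // S T _ T0 dST.
  by rewrite card_disjointU // ltn_addl.
apply: (@supp_inM _ xpredT _ _ _ _ (@supp_in_soul x)) => // S T S0 _ dST.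
by rewrite card_disjointU // ltn_addr.
Qed.

(** Moving e_S across e_T costs one sign for each of the |S| |T| pairs, because
each pair of distinct generators is an inversion of exactly one of the two
orders. *)
Lemma inversionsC (S T : {fset I}) : [disjoint S & T]%fset ->
  (inversions S T + inversions T S = #|` S| * #|` T|)%N.
Proof.
move=> dST; rewrite /inversions [X in (_ + X)%N]exchange_big -big_split /=.
rewrite card_fset_sum1 big_distrl /=.
rewrite big_seq [RHS]big_seq; apply: eq_bigr => i iS.
rewrite -big_split /= mul1n card_fset_sum1 big_seq [RHS]big_seq.
apply: eq_bigr => j jT; have: i != j.
  by apply: contraTneq jT => <-; apply: (fdisjointP dST).
by case: ltgtP.
Qed.

Lemma even_central x y : even_super x -> x * y = y * x.
Proof.
move=> ex; rewrite !superM exchange_big /= big_seq [RHS]big_seq.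
apply: eq_bigr => T _; rewrite big_seq [RHS]big_seq; apply: eq_bigr => S.
rewrite -mcoeff_neq0 => /ex oS; rewrite fsetUC [_ * y@__ * _]mulrAC.
congr (<< _ * _ * _ *g _ >>); rewrite /wedge_coef [in RHS]fdisjoint_sym.
case: ifPn => // dST; rewrite -signr_odd -[RHS]signr_odd.
have /(congr1 odd) := inversionsC dST.
by rewrite oddD oddM (negbTE oS) /=; do 2!case: odd.
Qed.

(** * Inverses and square roots of even supernumbers *)

(** This filtration replaces nilpotency: each step of the two iterations below
raises the degree k of the error, and no support is left once k exceeds the
number of generators in G. *)
Definition filt (G : {fset I}) k : pred {fset I} :=
  fun S => [&& ~~ odd #|` S|, (S `<=` G)%fset & (k <= #|` S|)%N].

Lemma filt_mul (G : {fset I}) k l x y :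
  supp_in (filt G k) x -> supp_in (filt G l) y ->
  supp_in (filt G (k + l)) (x * y).
Proof.
apply: supp_inM => S T /and3P[/negbTE oS SG kS] /and3P[/negbTE oT TG lT] dST.
by rewrite /filt fsubUset SG TG card_disjointU // oddD oS oT leq_add.
Qed.

Lemma filt_even (G : {fset I}) k x : supp_in (filt G k) x -> even_super x.
Proof. by apply: supp_in_sub => S /and3P[]. Qed.

Lemma filt_body (G : {fset I}) k x :
  (0 < k)%N -> supp_in (filt G k) x -> body x = 0.
Proof.
move=> k0 xG; apply/supp_in_body0/(supp_in_sub _ xG) => S /and3P[_ _].
exact: leq_trans.
Qed.

Lemma filt_gt (G : {fset I}) k x :
  (#|` G| < k)%N -> supp_in (filt G k) x -> x = 0.
Proof.
move=> Gk xG; apply/malgP => S; rewrite mcoeff0; apply/eqP.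
apply: contraT => /xG /and3P[_ /fsubset_leq_card SG kS].
by have := leq_trans (leq_ltn_trans SG Gk) kS; rewrite ltnn.
Qed.

Lemma filt_scalar (G : {fset I}) a : supp_in (filt G 0) (scalar a).
Proof. by apply: supp_inU; rewrite /filt cardfs0 fsub0set. Qed.

Lemma filt_soul x : even_super x ->
  exists G : {fset I}, supp_in (filt G 1) (x - scalar (body x)).
Proof.
move=> ex; exists (\bigcup_(S <- msupp x) S)%fset => S.
rewrite mcoeffB mcoeffU; have [<-|S0] := eqVneq fset0 S.
  by rewrite subrr eqxx.
rewrite subr0 => xS; rewrite /filt (ex _ xS) lt0n cardfs_eq0 eq_sym S0 andbT.
by rewrite (@bigfcup_sup _ _ _ S xpredT id) // -mcoeff_neq0.
Qed.

(** Let e = 1 - x y be the error of an approximate inverse y, and beta the body of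
x.  Replacing y by y + e / beta makes the error e (1 - x / beta), which has higher
degree because 1 - x / beta has zero body. *)
Lemma even_super_inverse x : even_super x -> body x != 0 ->
  exists2 y, even_super y & x * y = 1.
Proof.
move=> ex bx; have [G xG] := filt_soul ex.
suff [y ey Hy] : exists2 y, even_super y
    & supp_in (filt G #|` G|.+1) (1 - x * y).
  by exists y => //; apply/esym/eqP; rewrite -subr_eq0 (filt_gt _ Hy).
elim: #|` G|.+1 => [|k [y ey Hy]].
  by exists 0 => [|]; [apply: supp_in0|rewrite mulr0 subr0; apply: filt_scalar].
set e := 1 - x * y in Hy *; set b := scalar (body x)^-1.
have bE : scalar (body x) * b = 1 by rewrite scalarM mulfV.
exists (y + e * b).
  apply: supp_inD => //; apply: even_superM; last exact: even_scalar.
  exact: filt_even Hy.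
rewrite mulrDr opprD addrA -/e mulrA -[X in X - _]mulr1 -bE.
rewrite (even_central e ex) -mulrA -mulrBr -mulrBl.
rewrite -[in X in e * X]opprB mulNr mulrN.
rewrite -addn1 -[(k + 1)%N]addn0; apply/supp_inN; rewrite mulrA.
exact: filt_mul (filt_mul Hy xG) (@filt_scalar G _).
Qed.

(** Newton's iteration with the constant derivative 2 beta, where beta is the root
of the body: with y = beta + m, x = y ^+ 2 + e and q = e / (2 beta), replacing y by
y + q makes the error - (2 q m + q ^+ 2), of higher degree than e because m and q
have zero body. *)
Lemma super_sqrt_exists x : even_super x -> 0 < body x ->
  exists y, is_super_sqrt x y.
Proof.
move=> ex bx; have [G xG] := filt_soul ex; set beta := Num.sqrt (body x).
have beta0 : 0 < beta by rewrite sqrtr_gt0.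
suff [y Hm He] : exists2 y, supp_in (filt G 1) (y - scalar beta)
    & supp_in (filt G #|` G|.+1) (x - y ^+ 2).
  exists y; split.
  - rewrite -(subrK (scalar beta) y); apply: supp_inD; last exact: even_scalar.
    exact: filt_even Hm.
  - rewrite -(subrK (scalar beta) y) bodyD body_scalar.
    by rewrite (filt_body _ Hm) // add0r.
  - by apply/esym/eqP; rewrite -subr_eq0 (filt_gt _ He).
elim: #|` G| => [|k [y Hm He]].
  exists (scalar beta); first by rewrite subrr; apply: supp_in0.
  by rewrite expr2 scalarM -expr2 sqr_sqrtr // ltW.
set m := y - _ in Hm; set e := x - _ in He; set h := scalar (2 * beta)^-1.
have eh : even_super h by apply: even_scalar.
have ee : even_super e by apply: filt_even He.
set q := e * h; have Hq : supp_in (filt G k.+1) q.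
  by rewrite -[k.+1]addn0; apply: filt_mul He (@filt_scalar G _).
have Hq1 : supp_in (filt G 1) q.
  apply: supp_in_sub Hq => S /and3P[S1 S2 S3].
  by rewrite /filt S1 S2 (leq_trans _ S3).
exists (y + q); first by rewrite addrAC; apply: supp_inD.
have qE : q * scalar beta *+ 2 = e.
  have hE : (2 * beta)^-1 * beta *+ 2 = 1.
    rewrite -mulrnAr -[beta *+ 2]mulr_natl mulVf //.
    by rewrite mulf_neq0 ?pnatr_eq0 // gt_eqF.
  by rewrite -mulrA scalarM -mulrnAr -monalgUMn hE mulr1.
have -> : x - (y + q) ^+ 2 = - (q * m *+ 2 + q * q).
  have qy : q * y *+ 2 = q * m *+ 2 + e.
    by rewrite -{1}(subrK (scalar beta) y) -/m mulrDr mulrnDl qE.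
  rewrite expr2 mulrDl [y * _]mulrDr [q * (y + _)]mulrDr -expr2.
  rewrite -(even_central y (filt_even Hq)).
  rewrite -addrA [q * y + _]addrA -mulr2n qy opprD addrA -/e.
  by rewrite [_ + e + _]addrAC opprD addrCA subrr addr0.
rewrite mulr2n -mulrDr -addn1; apply/supp_inN.
rewrite -mulrDr; apply: filt_mul => //.
by apply: supp_inD Hq1; apply: supp_inD.
Qed.

Lemma even_unit_inv x : even_super x -> body x != 0 ->
  x \is a GRing.unit /\ even_super x^-1.
Proof.
move=> ex bx; have [y ey xy] := even_super_inverse ex bx.
have ux : x \is a GRing.unit.
  by apply/unitrP; exists y; rewrite (even_central x ey).
by split=> //; rewrite -[x^-1]mulr1 -xy mulKr.
Qed.

Lemma even_unit x : even_super x -> body x != 0 -> x \is a GRing.unit.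
Proof. by move=> ex /(even_unit_inv ex)[]. Qed.

Lemma even_superV x : even_super x -> body x != 0 -> even_super x^-1.
Proof. by move=> ex /(even_unit_inv ex)[]. Qed.

Lemma bodyV x : x \is a GRing.unit -> body x^-1 = (body x)^-1.
Proof.
move=> ux; have bxV : body x * body x^-1 = 1 by rewrite -bodyM divrr // body1.
by rewrite -[LHS](mulKf (_ : body x != 0)) ?bxV ?mulr1 //;
  apply: contra_eq_neq bxV => ->; rewrite mul0r eq_sym oner_eq0.
Qed.

Definition pos x := even_super x /\ 0 < body x.

Lemma pos1 : pos 1.
Proof. by split; [apply: even_super1|rewrite body1]. Qed.

Lemma posM x y : pos x -> pos y -> pos (x * y).
Proof.
by move=> [ex bx] [ey by_]; split; [apply: even_superM|rewrite bodyM mulr_gt0].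
Qed.

Lemma pos_unit x : pos x -> x \is a GRing.unit.
Proof. by case=> ex bx; rewrite even_unit // gt_eqF. Qed.

Lemma posV x : pos x -> pos x^-1.
Proof.
move=> px; have [ex bx] := px.
split; first by apply: even_superV; rewrite ?gt_eqF.
by rewrite bodyV ?pos_unit // invr_gt0.
Qed.

Lemma pos_prod (J : Type) (r : seq J) (P : pred J) (F : J -> Lam) :
  (forall j, pos (F j)) -> pos (\prod_(j <- r | P j) F j).
Proof. by move=> pF; apply: big_ind => // *; [apply: pos1|apply: posM]. Qed.

(** Two roots y, z satisfy (y - z) (y + z) = 0, and y + z has positive body. *)
Lemma super_sqrt_eq x y : is_super_sqrt x y -> super_sqrt x = y.
Proof.
move=> xy; have := @xgetI _ 0 [set z | is_super_sqrt x z]%classic y xy.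
rewrite -/(super_sqrt x) => -[ez bz zx]; have [ey by_ yx] := xy.
have u : super_sqrt x + y \is a GRing.unit.
  by apply: pos_unit; split; [apply: supp_inD|rewrite bodyD addr_gt0].
apply: (mulrI u); rewrite !mulrDl -!expr2 zx yx addrC.
by rewrite (even_central _ ey).
Qed.

Lemma super_sqrtP x : pos x -> is_super_sqrt x (super_sqrt x).
Proof. by case=> ex bx; apply: xgetPex; apply: super_sqrt_exists. Qed.

Lemma pos_sqrt x : pos x -> pos (super_sqrt x).
Proof. by case/super_sqrtP. Qed.

Lemma super_sqrt1 : super_sqrt 1 = 1 :> Lam.
Proof.
by apply: super_sqrt_eq; have [e1 b1] := pos1; split=> //; rewrite expr1n.
Qed.

Lemma super_sqrtM x y : pos x -> pos y ->
  super_sqrt (x * y) = super_sqrt x * super_sqrt y.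
Proof.
move=> px py; apply: super_sqrt_eq.
have [sx bx xE] := super_sqrtP px; have [sy by_ yE] := super_sqrtP py.
have [e b] := posM (pos_sqrt px) (pos_sqrt py); split=> //.
by rewrite exprMn_comm ?xE ?yE //; apply: even_central.
Qed.

Lemma super_sqrt_prod (J : Type) (r : seq J) (P : pred J) (F : J -> Lam) :
    (forall j, pos (F j)) ->
  super_sqrt (\prod_(j <- r | P j) F j) = \prod_(j <- r | P j) super_sqrt (F j).
Proof.
move=> pF; elim: r => [|j r IHr]; first by rewrite !big_nil super_sqrt1.
rewrite !big_cons; case: ifP => // _.
by rewrite super_sqrtM ?IHr //; apply: pos_prod.
Qed.

Lemma even_prod (J : Type) (r : seq J) (P : pred J) (F : J -> Lam) :
  (forall j, even_super (F j)) -> even_super (\prod_(j <- r | P j) F j).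
Proof.
by move=> eF; apply: big_ind => // *; [apply: even_super1|apply: even_superM].
Qed.

Lemma even_prod_split (J : Type) (r : seq J) (P : pred J) (F G : J -> Lam) :
    (forall j, even_super (G j)) ->
  \prod_(j <- r | P j) (F j * G j) =
  (\prod_(j <- r | P j) F j) * (\prod_(j <- r | P j) G j).
Proof.
move=> eG; elim: r => [|j r IHr]; first by rewrite !big_nil mulr1.
rewrite !big_cons; case: ifP => // _; rewrite IHr -!mulrA; congr (_ * _).
by rewrite !mulrA (even_central _ (eG j)).
Qed.

Lemma even_prodV (J : Type) (r : seq J) (P : pred J) (F : J -> Lam) :
    (forall j, even_super (F j)) -> (forall j, F j \is a GRing.unit) ->
  \prod_(j <- r | P j) (F j)^-1 = (\prod_(j <- r | P j) F j)^-1.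
Proof.
move=> eF uF; elim: r => [|j r IHr]; first by rewrite !big_nil invr1.
rewrite !big_cons; case: ifP => // _; rewrite IHr.
have uP : \prod_(i <- r | P i) F i \is a GRing.unit.
  by apply: rpred_prod => j' _; apply: uF.
rewrite (even_central (\prod_(i <- r | P i) F i) (eF j)) invrM //.
Qed.
End Supernumbers.

(** * Lower triangular supermatrices and the stabiliser of the puncture *)

Section Supermatrices.
Variables (disp : Order.disp_t) (I : orderType disp) (R : realType).
Local Notation Lam := (super I R).
Implicit Types (a b c d f : Lam) (M N U : supermx I R).

Lemma smx_mul a al b ga f be c de d a' al' b' ga' f' be' c' de' d' :
  smx a al b ga f be c de d * smx a' al' b' ga' f' be' c' de' d' =
  smx (a * a' - al * ga' + b * c') (a * al' + al * f' + b * de')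
        (a * b' - al * be' + b * d')
      (ga * a' + f * ga' + be * c') (- (ga * al') + f * f' - be * de')
        (ga * b' + f * be' + be * d')
      (c * a' - de * ga' + d * c') (c * al' + de * f' + d * de')
        (c * b' - de * be' + d * d') :> supermx I R.
Proof.
apply: entryP => i j; rewrite entry_mul !big_ord_recl big_ord0 addr0 addrA.
by rewrite !entry_smx; case: i j => [[|[|[|]]] //= ?] [[|[|[|]]] //= ?].
Qed.

Lemma smx_entries M :
  M = smx (entry M 0 0) (entry M 0 1) (entry M 0 2)
          (entry M 1 0) (entry M 1 1) (entry M 1 2)
          (entry M 2 0) (entry M 2 1) (entry M 2 2).
Proof.
apply: entryP => i j; rewrite entry_smx.
by case: i j => [[|[|[|]]] //= ?] [[|[|[|]]] //= ?];
  congr (entry M _ _); apply: val_inj.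
Qed.

Lemma smx1 : smx 1 0 0 0 1 0 0 0 1 = 1 :> supermx I R.
Proof.
apply: entryP => i j; rewrite entry_smx [RHS]entry1.
by case: i j => [[|[|[|]]] //= ?] [[|[|[|]]] //= ?].
Qed.

Lemma smx_inj a al b ga f be c de d a' al' b' ga' f' be' c' de' d' :
  smx a al b ga f be c de d = smx a' al' b' ga' f' be' c' de' d' ->
  [/\ [/\ a = a', al = al' & b = b'], [/\ ga = ga', f = f' & be = be']
    & [/\ c = c', de = de' & d = d']].
Proof.
move=> h; have E i j := congr1 (fun M => entry M i j) h.
have := E 0 0; have := E 0 1; have := E 0 2; have := E 1 0; have := E 1 1.
have := E 1 2; have := E 2 0; have := E 2 1; have := E 2 2.
by rewrite !entry_smx.
Qed.

Lemma monodromy_factor (e th : Lam) (x : Lam) :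
  Zmx e * Upsilon x * Pplus th =
  smx (- e * (super_sqrt x)^-1) 0 0 (- th) 1 0
      (e * super_sqrt x) (- (e * super_sqrt x * th)) (- (e * super_sqrt x)).
Proof.
rewrite /Zmx /Upsilon /Pplus /Jmx !smx_mul.
rewrite !(mul0r, mulr0, mul1r, mulr1, addr0, add0r, subr0, sub0r, oppr0).
by rewrite !(mulN1r, mulrN1, mulrN, mulNr, opprK).
Qed.

Lemma supertranspose1 : supertranspose 1 = 1 :> supermx I R.
Proof. by rewrite -[in LHS]smx1 /supertranspose !entry_smx /= oppr0 smx1. Qed.

Lemma OSp1 : OSp (1 : supermx I R).
Proof.
split.
- move=> i j; rewrite [entry _ _ _]entry1; have [<-|_] := eqVneq i j.
    by rewrite /odd_pos addbb; apply: even_super1.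
  by case: odd_pos; apply: supp_in0.
- by rewrite -smx1 entry_smx /= body1.
- by rewrite mulr1 supertranspose1 mul1r.
Qed.

(** Only the last column (b, be, d) of U acts on the point (0, r, 0 | 0, 0), whose
image has last column b r d, be r d, d r d up to sign; so d ^+ 2 = 1 and
b = be = 0.  The relation U^st J U = J then gives d al = 0, d a = 1 and
f ^+ 2 = 1. *)
Lemma stabilizer_lower U (r : Lam) : even_super r -> 0 < body r -> OSp U ->
    minkowski_act U (minkowski 0 r 0 0 0) = minkowski 0 r 0 0 0 ->
  exists a ga f c de d : Lam,
    [/\ U = smx a 0 0 ga f 0 c de d, a * d = 1, d * a = 1 & f * f = 1].
Proof.
move=> er br0; have ur : r \is a GRing.unit by apply: pos_unit.
rewrite (smx_entries U); move: (entry U 0 0) (entry U 0 1) (entry U 0 2)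
  (entry U 1 0) (entry U 1 1) (entry U 1 2) (entry U 2 0) (entry U 2 1)
  (entry U 2 2) => a al b ga f be c de d.
case=> par _; have := par 0 0; rewrite entry_smx /= => ea {par}.
rewrite /minkowski_act /minkowski /supertranspose !entry_smx /=.
rewrite /Jmx !smx_mul.
rewrite !(mul0r, mulr0, mul1r, mulr1, addr0, add0r, subr0, sub0r, oppr0).
rewrite !(mulN1r, mulrN1, mulrN, mulNr, opprK).
move=> /smx_inj[_ [_ + _] [+ + _]] /smx_inj[[_ _ brd] [_ _ berd] [_ _ drd]].
have dd : d * d = 1.
  by apply: (mulrI ur); rewrite mulr1 mulrA (even_central d er).
have cancel_rd y : y * r * d = 0 -> y = 0.
  move=> yrd; apply: (mulIr ur); rewrite mul0r -[y * r]mulr1 -dd mulrA yrd.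
  by rewrite mul0r.
rewrite (cancel_rd _ brd) (cancel_rd _ berd).
rewrite !(mulr0, mul0r, addr0, subr0) => ff /oppr_inj da.
move/eqP; rewrite oppr_eq0 => /eqP dal.
have al0 : al = 0 by rewrite -[al]mul1r -dd -mulrA dal mulr0.
exists a, ga, f, c, de, d; split=> //; first by rewrite al0.
  by rewrite (even_central d ea).
by move: ff; rewrite al0 mulr0 mul0r oppr0 add0r addr0.
Qed.

Lemma lower_unit (a ga f c de d : Lam) : a * d = 1 -> d * a = 1 -> f * f = 1 ->
  smx a 0 0 ga f 0 c de d \is a @GRing.unit (supermx I R).
Proof.
move=> ad da ff.
(* Every array of this shape has a right inverse of the same shape, by forward
substitution; the right inverse of the right inverse must be the array itself. *)
have rinv a0 ga0 f0 c0 de0 d0 : a0 * d0 = 1 -> d0 * a0 = 1 -> f0 * f0 = 1 ->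
    exists ga' c' de' : Lam, smx a0 0 0 ga0 f0 0 c0 de0 d0 *
      smx d0 0 0 ga' f0 0 c' de' a0 = 1 :> supermx I R.
  move=> ad0 da0 ff0; exists (- (f0 * (ga0 * d0))).
  exists (- (a0 * (c0 * d0 + de0 * (f0 * (ga0 * d0))))), (- (a0 * (de0 * f0))).
  rewrite smx_mul -smx1 !(mulr0, mul0r, addr0, subr0, oppr0, add0r) ad0 ff0 da0.
  rewrite !mulrN opprK !(mulrA d0 a0) da0 !mul1r (mulrA f0 f0) ff0 mul1r.
  by rewrite !subrr.
have [ga1 [c1 [de1 rU]]] := rinv a ga f c de d ad da ff.
have [ga2 [c2 [de2 rV]]] := rinv d ga1 f c1 de1 a da ad ff.
set V := (X in _ * X = 1) in rU; set W := (X in _ * X = 1) in rV.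
apply/unitrP; exists V; split=> //.
by rewrite -[X in V * X]mulr1 -rV [X in V * X]mulrA rU mul1r.
Qed.

(** If U fixes the puncture, with middle row (ga, f, 0), and U M = M' U for M' of the
form asked for by the constraint, then the (2,1) entries give ga + f B = ga. *)
Lemma constraint_lower (r B C : Lam) :
    even_super r -> 0 < body r -> even_super C ->
  monodromy_constraint (minkowski 0 r 0 0 0) (smx 1 0 0 B 1 0 C (- B) 1)
    <-> B = 0.
Proof.
move=> er br eC; split=> [[U [e [b [OU fixU _ UMU]]]]|->].
  have [a [ga [f [c [de [d [UE ad da ff]]]]]]] :=
    stabilizer_lower er br OU fixU.
  have uU : U \is a GRing.unit by rewrite UE lower_unit.
  move/(congr1 (fun M => M * U)): UMU; rewrite divrK // UE !smx_mul.
  case/smx_inj => _ [+ _ _] _.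
  rewrite !(mul0r, mulr1, mul1r, addr0, add0r) => /eqP.
  rewrite addrC -subr_eq0 addrK => /eqP fB.
  by rewrite -[B]mul1r -ff -mulrA fB mulr0.
exists 1, false, C; split=> //; first exact: OSp1.
  by rewrite /minkowski_act mul1r supertranspose1 mulr1.
by rewrite invr1 mulr1 mul1r oppr0.
Qed.

(** With c = - e sqrt x this is the matrix computed in [monodromy_factor], since e
is its own inverse. *)
Definition lower_factor (c th : Lam) : supermx I R :=
  smx c^-1 0 0 (- th) 1 0 (- c) (c * th) c.

(** The inverse diagonal entries A and E satisfy A E = 1, which keeps the (3,2)
entry equal to S E along the product: c th + c S E = (S + th A) (E c).  The corner
C is described by its parity alone, since the constraint leaves the corner of its
target free. *)
Lemma lower_product (c th : nat -> Lam) m :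
    (forall k, even_super (c k)) -> (forall k, c k \is a GRing.unit) ->
    (forall k, even_super (c k)^-1) -> (forall k, odd_super (th k)) ->
  let S := \sum_(i < m) th i * \prod_(j < i) (c j)^-1 in
  exists2 C, even_super C &
    \prod_(k < m) lower_factor (c (rev_ord k)) (th (rev_ord k)) =
    smx (\prod_(j < m) (c j)^-1) 0 0 (- S) 1 0
        C (S * \prod_(j < m) c j) (\prod_(j < m) c j).
Proof.
move=> ec uc eVc oth; elim: m => [|m [C eC IH]] /=.
  exists 0; first exact: supp_in0.
  by rewrite !big_ord0 oppr0 mul0r smx1.
rewrite big_ord_recl /= subSS subn0.
under eq_bigr => k _ do rewrite subSS.
rewrite IH smx_mul !big_ord_recr /=.
set S := \sum_(i < m) _; set A := \prod_(j < m) (c j)^-1.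
set E := \prod_(j < m) c j.
have eA : even_super A by apply: even_prod.
have eE : even_super E by apply: even_prod.
have AE : A * E = 1.
  by rewrite /A even_prodV // mulVr //; apply: rpred_prod => j _; apply: uc.
have eS : odd_super S.
  by apply: supp_in_sum => i _ _; apply: odd_even_superM; last exact: even_prod.
exists (- c m * A - c m * th m * - S + c m * C).
  apply: supp_inD; last exact: even_superM.
  apply: supp_inB; first by apply: even_superM => //; apply: supp_inN (ec m).
  apply: odd_superM; last exact: supp_inN eS.
  by rewrite (even_central _ (ec m)); apply: odd_even_superM.
congr smx; rewrite ?(mul0r, mulr0, addr0, add0r, subr0, oppr0, mulr1, mul1r) //.
- exact: even_central.
- by rewrite opprD mulNr addrC.
- rewrite [RHS]mulrDl [RHS]addrC; congr (_ + _).
    by rewrite mulrA -[th m * A * E]mulrA AE mulr1; apply: even_central.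
  by rewrite (even_central _ (ec m)) mulrA.
- by rewrite (even_central _ (ec m)).
Qed.
End Supermatrices.

(** * The monodromy around a puncture *)

Section Puncture.
Variables (disp : Order.disp_t) (I : orderType disp) (R : realType).
Variables (g s : nat) (F : ideal_triangulation g s).
Variables (om : orientation F) (p : super_point I R F) (d : side F).
Local Notation Lam := (super I R).
Local Notation n := (valence d).
Local Notation ep := (eps I R om d).
Local Notation c := (cc om p d).

Lemma pos_lambda x : pos (lambda p x).
Proof. by split; [apply: lambda_even|apply: lambda_body]. Qed.

Lemma pos_chi k : pos (chi p d k).
Proof. by apply: posM; [apply: posM|apply/posV/posM]; apply: pos_lambda. Qed.

Lemma cross_ratio_ratio (u u' v v' w : Lam) :
    pos u -> pos u' -> pos v -> pos v' -> pos w ->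
  u * v' / (w * u') * (w * v / u) = v * v' / u'.
Proof.
move=> pu pu' pv pv' pw; rewrite invrM ?pos_unit // !mulrA divrK ?pos_unit //.
rewrite -!mulrA (even_central _ pu.1) !mulrA divrK ?pos_unit //.
by rewrite -(even_central _ pv.1) mulrA.
Qed.

Lemma exit_sideS k : exit_side d k.+1 = turn F (exit_side d k).
Proof. by rewrite /exit_side expgSr permM. Qed.

Lemma exit_side_valence : exit_side d n = exit_side d 0.
Proof. by rewrite /exit_side permX iter_porbit expg0 perm1. Qed.

(** chi_k is X_{k+1} / X_k with X_k = lambda(A B_k) lambda(A B_{k+1}) /
lambda(B_k B_{k+1}), so the product around the puncture telescopes. *)
Lemma prod_chi : \prod_(k < n) chi p d k = 1.
Proof.
pose X k := lambda p (Defs.rot F (exit_side d k)) * lambda p (exit_side d k) /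
  lambda p (Defs.rot F (Defs.rot F (exit_side d k))).
have chiX k : chi p d k * X k = X k.+1.
  rewrite /chi /X cross_ratio_ratio; try exact: pos_lambda.
  by rewrite exit_sideS [turn F _]permM permKV lambda_flip.
have prodX m : (\prod_(k < m) chi p d k) * X 0%N = X m.
  elim: m => [|m IHm]; first by rewrite big_ord0 mul1r.
  rewrite big_ord_recr /= -(even_central _ (pos_chi m).1) -mulrA.
  by rewrite IHm.
have uX : X 0%N \is a GRing.unit.
  by apply: pos_unit; apply: posM; [apply: posM|apply: posV]; apply: pos_lambda.
by apply: (mulIr uX); rewrite mul1r prodX /X exit_side_valence.
Qed.

Lemma epsE k : ep k = (-1) ^+ om (exit_side d k).
Proof. by rewrite /eps; case: (om _). Qed.

Lemma even_sign m : even_super ((-1) ^+ m : Lam).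
Proof.
by rewrite -signr_odd; case: odd; [apply: supp_inN|]; apply: even_super1.
Qed.

Lemma eps_sqr k : ep k * ep k = 1.
Proof. by rewrite epsE -expr2 sqrr_sign. Qed.

Lemma unit_eps k : ep k \is a GRing.unit.
Proof. by rewrite epsE unitrX ?unitrN1. Qed.

Lemma even_eps k : even_super (ep k).
Proof. by rewrite epsE; apply: even_sign. Qed.

Lemma even_cc k : even_super (c k).
Proof.
rewrite /cc; apply: even_superM; first apply: even_superN (@even_eps k).
exact: (pos_sqrt (pos_chi k)).1.
Qed.

Lemma unit_cc k : c k \is a GRing.unit.
Proof.
by rewrite rpredM ?rpredN ?unit_eps ?pos_unit //; apply/pos_sqrt/pos_chi.
Qed.

Lemma ccV k : (c k)^-1 = - ep k * (super_sqrt (chi p d k))^-1.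
Proof.
apply: (mulrI (unit_cc k)); rewrite divrr ?unit_cc // /cc.
rewrite -mulrA (mulrA (super_sqrt _)).
rewrite -(even_central (super_sqrt _) (even_superN (@even_eps k))) !mulrA.
by rewrite mulrNN eps_sqr mul1r divrr // pos_unit //; apply/pos_sqrt/pos_chi.
Qed.

Lemma even_ccV k : even_super (c k)^-1.
Proof.
rewrite ccV; apply: even_superM; first exact: even_superN (@even_eps k).
exact: (posV (pos_sqrt (pos_chi k))).1.
Qed.

Lemma odd_theta k : odd_super (theta p d k).
Proof. exact: mu_odd. Qed.

Lemma prod_oppr_eps (J : Type) (r : seq J) (f : J -> nat) :
  \prod_(j <- r) - ep (f j) = (-1) ^+ size r * (\prod_(j <- r) ep (f j)).
Proof.
elim: r => [|j r IHr]; first by rewrite !big_nil mulr1.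
rewrite !big_cons /= IHr exprS mulN1r !mulNr !mulrA.
by rewrite (even_central (ep _) (@even_sign _)).
Qed.

Lemma prod_cc (J : Type) (r : seq J) (f : J -> nat) :
  \prod_(j <- r) c (f j) =
  (-1) ^+ size r * (\prod_(j <- r) ep (f j)) *
    super_sqrt (\prod_(j <- r) chi p d (f j)).
Proof.
rewrite super_sqrt_prod; last by move=> j; apply: pos_chi.
rewrite /cc even_prod_split; last by move=> j; apply: (pos_sqrt (pos_chi _)).1.
by rewrite prod_oppr_eps.
Qed.

Lemma prod_ccV (J : Type) (r : seq J) (f : J -> nat) :
  \prod_(j <- r) (c (f j))^-1 =
  (-1) ^+ size r * (\prod_(j <- r) ep (f j)) /
    super_sqrt (\prod_(j <- r) chi p d (f j)).
Proof.
rewrite (eq_bigr _ (fun j _ => ccV (f j))).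
rewrite (@even_prod_split _ _ _ _ _ _ (fun j => - ep (f j))
  (fun j => (super_sqrt (chi p d (f j)))^-1)).
  rewrite prod_oppr_eps super_sqrt_prod; last by move=> j; apply: pos_chi.
  rewrite even_prodV => [//|j|j]; first exact: (pos_sqrt (pos_chi _)).1.
  exact: pos_unit (pos_sqrt (pos_chi _)).
by move=> j; apply: (posV (pos_sqrt (pos_chi _))).1.
Qed.

Lemma monodromyE : exists2 C : Lam, even_super C &
  let S := \sum_(i < n) theta p d i * \prod_(j < i) (c j)^-1 in
  monodromy om p d = smx (\prod_(j < n) (c j)^-1) 0 0 (- S) 1 0
     C (S * \prod_(j < n) c j) (\prod_(j < n) c j).
Proof.
have [C eC H] := lower_product n (@even_cc) unit_cc (@even_ccV) (@odd_theta).
exists C; rewrite /= -?H //; apply: eq_bigr => k _ /=.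
rewrite monodromy_factor /lower_factor ccV.
by rewrite /cc !mulNr opprK.
Qed.

(** As the chi_k have product 1, the product of the c_k is a product of signs; for
the value -1 the projected monodromy has trace -2. *)
Lemma ramond_prod_cc : ramond om p d -> \prod_(j < n) c j = 1.
Proof.
have [C eC ME] := monodromyE.
have E : \prod_(j < n) c j = 1 \/ \prod_(j < n) c j = -1.
  rewrite prod_cc prod_chi super_sqrt1 mulr1.
  have [N ->] : exists N, \prod_(j < n) ep j = (-1) ^+ N :> Lam.
    apply: (big_ind (fun x : Lam => exists N, x = (-1) ^+ N)).
    - by exists 0%N.
    - by move=> x y [N ->] [M ->]; exists (N + M)%N; rewrite exprD.
    - by move=> k _; rewrite epsE; eexists.
  by rewrite -exprD -signr_odd; case: odd; [right|left].
case: E => // E; rewrite /ramond ME E.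
rewrite even_prodV => [|j|j]; try exact: even_cc; try exact: unit_cc; rewrite E.
rewrite invrN1 /mxtrace !big_ord_recl big_ord0 addr0 !mxE !entry_smx /=.
rewrite body1 bodyN body1 sqrtr1 invr1 !mul1r => /eqP.
have lt2 : -1 - 1 < 2 :> R.
  apply: (@lt_trans _ _ 0); last exact: (ltr0n R 2).
  by rewrite -opprD oppr_lt0 (ltr0n R 2).
by rewrite (lt_eqF lt2).
Qed.

(** Up to sign, this is the odd part of the monodromy that no conjugation by an
element fixing the puncture can remove. *)
Definition obstruction : Lam :=
  \sum_(i < n) theta p d i * \prod_(j < i) (c j)^-1.

Lemma constraint_obstruction (r : Lam) :
    even_super r -> 0 < body r -> ramond om p d ->
  monodromy_constraint (minkowski 0 r 0 0 0) (monodromy om p d)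
    <-> obstruction = 0.
Proof.
move=> er br /ramond_prod_cc cE; have [C eC /= ->] := monodromyE.
rewrite even_prodV => [|j|j]; try exact: even_cc; try exact: unit_cc.
rewrite cE invr1 mulr1 -/obstruction -{2}[obstruction]opprK.
rewrite (constraint_lower _ er br eC).
by split=> [/eqP|->]; rewrite ?oppr0 // oppr_eq0 => /eqP.
Qed.

Lemma sum_head_ccV :
  \sum_(i < n) theta p d i * \prod_(j < n | (j < i)%N) (c j)^-1 = obstruction.
Proof.
apply: eq_bigr => i _; congr (_ * _).
by rewrite (big_ord_widen n (fun j => (c j)^-1)) // ltnW.
Qed.

Lemma sum_head_sqrt_chi :
  \sum_(i < n) (-1) ^+ i * theta p d i *
    (\prod_(j < n | (j < i)%N) ep j /
     super_sqrt (\prod_(j < n | (j < i)%N) chi p d j)) = obstruction.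
Proof.
apply: eq_bigr => i _; have le_in := ltnW (ltn_ord i).
rewrite -!(big_ord_widen n _ le_in) -(big_mkord xpredT ep)
  -(big_mkord xpredT (chi p d)) -(big_mkord xpredT (fun j => (c j)^-1)).
rewrite (prod_ccV _ id) size_iota subn0.
by rewrite (even_central _ (@even_sign _)) !mulrA.
Qed.

Lemma sum_tail_cc :
  \sum_(i < n) theta p d i * \prod_(j < n | (i <= j)%N) c j =
  obstruction * \prod_(k < n) c k.
Proof.
rewrite mulr_suml; apply: eq_bigr => i _; rewrite -mulrA; congr (_ * _).
rewrite -(big_mkord xpredT c) (big_cat_nat _ (ltnW (ltn_ord i))) //= mulrA.
rewrite -(big_geq_mkord i n xpredT c) big_mkord even_prodV => [|j|j].
- rewrite mulVr ?mul1r //; apply: rpred_prod => j _; exact: unit_cc.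
- exact: even_cc.
- exact: unit_cc.
Qed.

Lemma sum_tail_sqrt_chi :
  \sum_(i < n) (-1) ^+ i * theta p d i *
    super_sqrt (\prod_(j < n | (i <= j)%N) chi p d j) *
    \prod_(j < n | (i <= j)%N) ep j =
  (-1) ^+ n * \sum_(i < n) theta p d i * \prod_(j < n | (i <= j)%N) c j.
Proof.
rewrite mulr_sumr; apply: eq_bigr => i _; rewrite -!(big_geq_mkord i n xpredT).
rewrite (prod_cc _ id) size_iota.
set P := \prod_(i <= j < n) ep j; set s0 := super_sqrt _.
have eP : even_super P by apply: even_prod => j; apply: even_eps.
rewrite -[LHS]mulrA -(even_central _ eP) -[_ * P * s0]mulrA.
rewrite (mulrA (theta p d i)) -(even_central _ (@even_sign _)) !mulrA.
(* the signs agree because n + (n - i) and i have the same parity *)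
congr (_ * _ * _ * _); rewrite -exprD -signr_odd -[RHS]signr_odd addnC.
by rewrite oddD oddB ?(ltnW (ltn_ord i)) // -addbA addbC addbK.
Qed.
End Puncture.

Theorem theorem5p3 (R : realType) (disp : Order.disp_t) (I : orderType disp)
  (g s : nat) (hs : (1 <= s)%N) (hgs : (2 < g.*2 + s)%N)
  (F : ideal_triangulation g s) (om : orientation F) (p : super_point I R F)
  (d : side F) (r : super I R) (hr : even_super r) (hr0 : 0 < body r) :
  let n := valence d in
  let th := theta p d in
  let ch := chi p d in
  let ep := eps I R om d in
  let c := cc om p d in
  let constraint :=
    monodromy_constraint (minkowski 0 r 0 0 0) (monodromy om p d) in
  ramond om p d ->
  [/\ constraint <->
        \sum_(i < n) th i * \prod_(j < n | (j < i)%N) (c j)^-1 = 0,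
      constraint <->
        \sum_(i < n) (-1) ^+ i * th i *
          (\prod_(j < n | (j < i)%N) ep j /
           super_sqrt (\prod_(j < n | (j < i)%N) ch j)) = 0,
      constraint <->
        \sum_(i < n) th i * \prod_(j < n | (i <= j)%N) c j = 0,
      constraint <->
        \sum_(i < n) (-1) ^+ i * th i *
          super_sqrt (\prod_(j < n | (i <= j)%N) ch j) *
          \prod_(j < n | (i <= j)%N) ep j = 0
    & (\sum_(i < n) th i * \prod_(j < n | (j < i)%N) (c j)^-1) *
        \prod_(k < n) c k =
      \sum_(i < n) th i * \prod_(j < n | (i <= j)%N) c j].
Proof.
move=> n th ch ep c constraint ram.
have E := constraint_obstruction hr hr0 ram.
rewrite sum_head_ccV sum_head_sqrt_chi sum_tail_sqrt_chi sum_tail_cc.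
rewrite (ramond_prod_cc ram) mulr1; split=> //; rewrite /constraint E.
split=> [->|/(congr1 ( *%R ((-1) ^+ n)))]; first by rewrite mulr0.
by rewrite mulrA -exprD addnn -signr_odd odd_double mul1r mulr0.
Qed.
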